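(* Let $\sigma_2 = 2$ and $\sigma_3 = C_0$, where $C_0 \approx 13.901$ is the constant described in the context. Let $q \in \{2,3\}$, let $k \geq 2$, and let $t_1, \ldots, t_k$ be integers with $t_k \geq t_{k-1} \geq \cdots \geq t_1 \geq 2$. Then \[R_q(t_1, \ldots, t_k) \leq \tau_h(3t_k), \qquad \text{where } h = \sum_{i=1}^{k-1}(t_i - 1) + 1,\] and $\tau_h$ denotes the tower function with base $\sigma_q$: $\tau_1(x) = x$ and $\tau_{j+1}(x) = \sigma_q^{\tau_j(x)}$ for $j \geq 1$ (so $\tau_h(3t_k)$ is a tower $\sigma_q^{\sigma_q^{\cdot^{\cdot^{\sigma_q^{3t_k}}}}}$ of height $h$, counting the top entry $3t_k$ as one level).
   Context: For a finite field $\mathbb F_q$ and positive integers $t_1,\ldots,t_k$, $R_q(t_1,\ldots,t_k)$ denotes the minimum $n$ such that for every coloring $f$ of the set of $1$-dimensional linear subspaces of $\mathbb F_q^n$ with colors $\{1,\ldots,k\}$, there exist $i \in \{1,\ldots,k\}$ and a linear subspace $U \subseteq \mathbb F_q^n$ of dimension $t_i$ such that every $1$-dimensional subspace of $U$ receives color $i$ (this minimum exists by the Graham–Leeb–Rothschild theorem). The constant $C_0 \approx 13.901$ is the absolute constant $C_0 = 1 + 1/(1-\log_3 \gamma)$ with $\gamma = \min_{0<x<1}(1+x+x^2)/x^{2/3} \approx 2.7552$ (the constant of Fox–Pham's theorem on affine subspaces in dense subsets of $\mathbb F_3^n$); it has the known property that every $A \subseteq \mathbb F_3^n$ with $|A|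 = \alpha 3^n$ contains at least $\alpha^{C_0} 3^{2n}$ triples of the form $(x, x+d, x+2d)$ with $x,d \in \mathbb F_3^n$. *)

(* Defs.v *)
From HB Require Import structures.
From mathcomp Require Import all_boot all_order all_algebra all_field.
From mathcomp Require Import all_classical all_reals all_analysis.
Set Implicit Arguments. Unset Strict Implicit. Unset Printing Implicit Defensive.
Import Order.TTheory GRing.Theory Num.Theory.
Local Open Scope classical_set_scope.
Local Open Scope ring_scope.

(* gamma = min_{0<x<1} (1+x+x^2)/x^(2/3); the minimum is attained, so it equals the infimum. *)
Definition gamma_FP (R : realType) : R :=
  inf [set (1 + x + x ^+ 2) / x `^ (2 / 3) | x in `]0, 1[%classic].

Definition C0 (R : realType) : R :=
  1 + 1 / (1 - ln (gamma_FP R) / ln 3).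

Definition sigma_q (R : realType) (q : nat) : R :=
  if q == 2%N then 2 else C0 R.

Fixpoint iter_tower (R : realType) (s : R) (m : nat) (x : R) : R :=
  match m with
  | 0%N => x
  | m'.+1 => s `^ (iter_tower s m' x)
  end.

Definition tau (R : realType) (s : R) (h : nat) (x : R) : R := iter_tower s h.-1 x.

Definition ramsey_prop (q k : nat) (t : nat -> nat) (n : nat) : Prop :=
  forall f : {vspace 'rV['F_q]_n} -> nat,
    (forall L : {vspace 'rV['F_q]_n}, \dim L = 1%N -> (1 <= f L <= k)%N) ->
    exists i : nat, (1 <= i <= k)%N /\
      exists U : {vspace 'rV['F_q]_n}, \dim U = t i /\
        forall L : {vspace 'rV['F_q]_n}, \dim L = 1%N -> (L <= U)%VS -> f L = i.

(* Main.v *)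
Require Import Defs.
From HB Require Import structures.
From mathcomp Require Import all_boot all_order all_algebra all_field.
From mathcomp Require Import all_classical all_reals all_analysis.
From mathcomp Require Import zify ring lra.
Set Implicit Arguments. Unset Strict Implicit. Unset Printing Implicit Defensive.
Import Order.TTheory GRing.Theory Num.Theory.
Local Open Scope ring_scope.

(** Induct on H = sum_(i<k) (t_i - 1). Either color k contains a subspace of dimension t_k, built
    greedily, or the colors below k cover a fraction at least q^(-t_k) of the points, so that some
    color i < k has density about q^(-t_k)/H. A set of density d in F_q^n contains an affine
    m-space x + W as soon as n is of order b^m log(1/d): averaging over the translates of a small
    subspace, the bound on line-free sets (trivial for q = 2, Ellenberg-Gijswijt for q = 3) gives a
    direction v such that {x | x + F_q v in A} still has density polynomial in d. As 0 is not
    colored, x is outside W; applying the induction hypothesis to W with t_i - 1 in place of t_i,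
    either some color wins inside W, or color i contains U of dimension t_i - 1 and hence U + <x>.

    For q = 3 the argument uses b = 16 > C_0 and only C_0 >= 7: the factor 3 in the top entry 3 t_k
    of the tower absorbs the difference, as 16 <= 7^(3/2). *)

(** * Sets without affine lines over F_3: the slice-rank bound *)

Definition affine_line_free (F : finFieldType) (n : nat) (B : {set 'rV[F]_n}) :=
  forall x v : 'rV[F]_n, v != 0 -> ~ (forall c : F, x + c *: v \in B).

Definition low_exponents (e : nat) : {set {ffun 'I_(3 * e) -> 'I_3}} :=
  [set a : {ffun 'I_(3 * e) -> 'I_3} | (\sum_l a l <= 2 * e)%N].

(** Chernoff bound with weight [2 ^ (2 - a l)] per coordinate: the total weight is (4 + 2 + 1)^(3e)
    = 343^e, and each low vector weighs at least 2^(6e - 2e) = 16^e. *)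
Lemma card_low_exponents e : (#|low_exponents e| * 16 ^ e <= 343 ^ e)%N.
Proof.
have -> : (343 ^ e = \sum_(a : {ffun 'I_(3 * e) -> 'I_3}) \prod_l 2 ^ (2 - a l))%N.
  rewrite -(bigA_distr_bigA (fun _ (j : 'I_3) => 2 ^ (2 - j))%N).
  rewrite prod_nat_const card_ord expnM !big_ord_recl big_ord0.
  by congr expn.
rewrite [X in (_ <= X)%N](bigID (mem (low_exponents e))) /=.
apply: leq_trans (leq_addr _ _); rewrite -sum_nat_const; apply: leq_sum => a.
rewrite inE => lea.
have -> : (16 ^ e = 2 ^ (4 * e))%N by rewrite expnM.
rewrite -expn_sum leq_exp2l //.
have : (\sum_l (2 - a l) + \sum_l a l = 2 * (3 * e))%N.
  transitivity (\sum_(l < 3 * e) 2)%N; last by rewrite sum_nat_const card_ord mulnC.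
  by rewrite -big_split; apply: eq_bigr => l _; rewrite /= subnK // -ltnS.
set S := (\sum_l (2 - a l))%N. set S' := (\sum_l a l)%N in lea *. lia.
Qed.

(** A row basis of [K] has an invertible minor on [\rank K] columns, so the entries there can be
    prescribed; all are taken to be 1. *)
Lemma submx_vector_ones (F : fieldType) (m n : nat) (K : 'M[F]_(m, n)) :
  exists2 h : 'rV[F]_n, (h <= K)%MS &
    exists2 g : 'I_(\rank K) -> 'I_n, injective g & forall i, h 0 (g i) = 1.
Proof.
set r := \rank K.
have rfT : row_full (row_base K)^T by rewrite /row_full mxrank_tr eq_row_base.
pose g := fullrankfun rfT.
have U : (rowsub g (row_base K)^T)  \in unitmx by apply: fullrowsub_unit.
set B := rowsub _ _ in U.
have UT : B^T \in unitmx by rewrite unitmx_tr.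
exists ((const_mx 1 : 'rV_r) *m invmx B^T *m row_base K).
  by apply: submx_trans (submxMl _ _) _; rewrite eq_row_base.
exists g => [|i]; first exact: fullrankfun_inj.
have -> : forall h : 'rV[F]_n, h 0 (g i) = (colsub g h) 0 i by move=> h; rewrite mxE.
rewrite -mulmx_colsub; have -> : colsub g (row_base K) = B^T.
  by apply/matrixP => a b; rewrite !mxE.
by rewrite mulmxKV // mxE.
Qed.


Definition monomial (F : fieldType) n (a : {ffun 'I_n -> 'I_3}) (x : 'rV[F]_n) : F :=
  \prod_l x 0 l ^+ a l.

(* 1 - (x+y+z)^2 over F_3 as a sum of seven monomials (exponents of x, y, z and coefficient) *)
Definition ind_terms : seq (('I_3 * 'I_3 * 'I_3) * 'F_3) :=
  [:: ((inord 0, inord 0, inord 0), 1);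
      ((inord 2, inord 0, inord 0), -1);
      ((inord 0, inord 2, inord 0), -1);
      ((inord 0, inord 0, inord 2), -1);
      ((inord 1, inord 1, inord 0), 1);
      ((inord 1, inord 0, inord 1), 1);
      ((inord 0, inord 1, inord 1), 1)].
Definition ind_term (p : 'I_7) := nth ((inord 0, inord 0, inord 0), 1) ind_terms p.

Lemma ind_termE (x y z : 'F_3) :
  ((x + y + z == 0)%:R : 'F_3) =
  \sum_p (ind_term p).2 * (x ^+ (ind_term p).1.1.1 * y ^+ (ind_term p).1.1.2 * z ^+ (ind_term p).1.2).
Proof.
rewrite !big_ord_recl big_ord0 /ind_term /= !inordK //.
by move: x y z => [[|[|[|//]]] ?] [[|[|[|//]]] ?] [[|[|[|//]]] ?]; apply/val_inj.
Qed.

Lemma ind_term_deg p :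
  ((ind_term p).1.1.1 + (ind_term p).1.1.2 + (ind_term p).1.2 <= 2)%N.
Proof.
by case: p => [[|[|[|[|[|[|[|//]]]]]]] ?]; rewrite /ind_term /= !inordK.
Qed.

Section Capset.
Variables (e : nat) (B : {set 'rV['F_3]_(3 * e)}).
Hypothesis lfB : affine_line_free B.

Let expo (pr : 'I_3 * 'I_3 * 'I_3 -> 'I_3) (phi : {ffun 'I_(3 * e) -> 'I_7}) :
  {ffun 'I_(3 * e) -> 'I_3} := [ffun l => pr (ind_term (phi l)).1].
Let ea := expo (fun p => p.1.1).
Let eb := expo (fun p => p.1.2).
Let ec := expo (fun p => p.2).
Let coeff (phi : {ffun 'I_(3 * e) -> 'I_7}) : 'F_3 := \prod_l (ind_term (phi l)).2.

Lemma sum0_indicator_expansion (x y z : 'rV['F_3]_(3 * e)) :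
  (x + y + z == 0)%:R =
  \sum_phi coeff phi * (monomial (ea phi) x * monomial (eb phi) y * monomial (ec phi) z).
Proof.
have -> : (x + y + z == 0)%:R = \prod_l (x 0 l + y 0 l + z 0 l == 0)%:R :> 'F_3.
  have [/rowP xyz|/eqP xyz] := eqVneq.
    by rewrite big1 // => l _; have := xyz l; rewrite !mxE => ->; rewrite eqxx.
  apply/esym/eqP/prodf_eq0.
  have /existsP[l /negPf xl] : [exists l, x 0 l + y 0 l + z 0 l != 0].
    apply/existsPn => xyz0; apply: xyz; apply/rowP => l; rewrite !mxE.
    by apply/eqP; have := xyz0 l; rewrite negbK.
  by exists l => //; rewrite xl.
under eq_bigr do rewrite ind_termE.
rewrite bigA_distr_bigA; apply: eq_bigr => phi _.
rewrite /coeff /monomial -!big_split; apply: eq_bigr => l _.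
by rewrite !ffunE.
Qed.

(** Each coordinate contributes degree at most 2, hence 6e in all, so one of the three factors has
    degree at most 2e. *)
Lemma exponents_low phi :
  [|| ea phi \in low_exponents e, eb phi \in low_exponents e | ec phi \in low_exponents e].
Proof.
have : (\sum_l ea phi l + \sum_l eb phi l + \sum_l ec phi l <= 2 * (3 * e))%N.
  rewrite -!big_split /=; apply: (@leq_trans (\sum_(l < 3 * e) 2)%N); last first.
    by rewrite sum_nat_const card_ord mulnC.
  by apply: leq_sum => l _; rewrite !ffunE ind_term_deg.
by rewrite !inE; lia.
Qed.

(** In characteristic 3, x + y + z = 0 means z = x - (y - x), so distinct x and y would span a full
    line in B. *)
Lemma sum0_line_free x y z : x \in B -> y \in B -> z \in B -> x + y + z = 0 -> x = y.
Proof.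
move=> xB yB zB xyz; apply/eqP/negPn/negP => neq.
apply: (lfB (x := x) (v := y - x)); first by rewrite subr_eq0 eq_sym.
have char3 (v : 'rV['F_3]_(3 * e)) : v + v + v = 0.
  by apply/rowP => l; rewrite !mxE; case: (v 0 l) => [[|[|[|//]]] ?]; apply/val_inj.
case=> [[|[|[|//]]] ?].
- by rewrite (_ : Ordinal _ = 0) ?scale0r ?addr0 //; apply/val_inj.
- by rewrite (_ : Ordinal _ = 1) ?scale1r ?subrKC //; apply/val_inj.
rewrite (_ : Ordinal _ = -1); last by apply/val_inj.
rewrite scaleN1r opprB (_ : x + (x - y) = z) //.
have -> : z = - (x + y).
  by apply/eqP; rewrite -addr_eq0 addrC xyz.
by apply/eqP; rewrite -subr_eq0 opprK [x + y]addrC !addrA subrK char3.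
Qed.

(** Take [h] on B orthogonal to all low monomials and equal to 1 at r >= N - M places. Contracting
    the indicator of x + y + z = 0 with [h] in z gives the identity matrix of size r. Only terms
    with a low factor in x or in y survive, and each kind has rank at most M. Thus N - M <= r <=
    2M. *)
Lemma line_free_card_F3 : (#|B| <= 3 * #|low_exponents e|)%N.
Proof.
set Lw := low_exponents e; set M := #|Lw|; set N := #|B|.
pose bv (i : 'I_N) : 'rV['F_3]_(3 * e) := enum_val i.
have bvB i : bv i \in B by apply: enum_valP.
pose K : 'M['F_3]_(N, M) := \matrix_(i, j) monomial (enum_val j) (bv i).
have [h /sub_kermxP hK [g g_inj g1]] := submx_vector_ones (kermx K).
have h_low a : a \in Lw -> \sum_i h 0 i * monomial a (bv i) = 0.
  move=> aL; have := congr1 (fun X : 'rV_M => X 0 (enum_rank_in aL a)) hK.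
  rewrite !mxE => h0; rewrite -[RHS]h0; apply: eq_bigr => i _.
  by rewrite mxE enum_rankK_in.
have : (N - M <= \rank (kermx K))%N.
  by rewrite mxrank_ker leq_sub2l // rank_leq_col.
set r := \rank _ in g g_inj g1 *.
suff : (r <= M + M)%N by lia.
pose y i := bv (g i).
(* On B the sum vanishes only if the three points agree, so the only surviving index is k = g i,
   where [h] is 1. *)
have deltaE i j : \sum_k h 0 k * (y i + y j + bv k == 0)%:R = (i == j)%:R.
  have [<-|neq] := eqVneq i j; last first.
    rewrite big1 // => k _; have [xyz|] := eqVneq; last by rewrite mulr0.
    case/eqP: neq; apply: g_inj; apply: enum_val_inj.
    exact: (sum0_line_free (bvB _) (bvB _) (bvB k)).
  rewrite (bigD1 (g i)) //= g1 big1 => [|k /negPf neq].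
    rewrite addr0 mul1r (_ : y i + y i + bv (g i) = 0) ?eqxx //.
    apply/rowP => l; rewrite !mxE.
    by case: (bv (g i) 0 l) => [[|[|[|//]]] ?]; apply/val_inj.
  have [xyz|] := eqVneq; last by rewrite mulr0.
  case/negP: (negbT neq); apply/eqP; apply: enum_val_inj.
  rewrite -addrA [_ + bv k]addrC addrA in xyz.
  by apply/esym/(sum0_line_free (bvB _) (bvB _) (bvB (g i)) xyz).
pose c phi := \sum_k h 0 k * monomial (ec phi) (bv k).
pose T i j phi := coeff phi * monomial (ea phi) (y i) * monomial (eb phi) (y j) * c phi.
have deltaT i j : (i == j)%:R = \sum_phi T i j phi.
  rewrite -deltaE; under eq_bigr do rewrite sum0_indicator_expansion mulr_sumr.
  rewrite exchange_big; apply: eq_bigr => phi _ /=.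
  rewrite /T /c mulr_sumr; apply: eq_bigr => k _; ring.
(* Both products factor through the M low monomials: the first gathers the terms with [ea phi] low,
   the second the remaining ones with [eb phi] low. *)
pose P1 : 'M['F_3]_(r, M) := \matrix_(i, a) monomial (enum_val a) (y i).
pose Q1 : 'M['F_3]_(M, r) := \matrix_(a, j)
  \sum_(phi | ea phi == enum_val a) coeff phi * monomial (eb phi) (y j) * c phi.
pose P2 : 'M['F_3]_(r, M) := \matrix_(i, b)
  \sum_(phi | (ea phi \notin Lw) && (eb phi == enum_val b))
     coeff phi * monomial (ea phi) (y i) * c phi.
pose Q2 : 'M['F_3]_(M, r) := \matrix_(b, j) monomial (enum_val b) (y j).
have PQ : 1%:M = P1 *m Q1 + P2 *m Q2.
  apply/matrixP => i j; rewrite !mxE deltaT (bigID (fun phi => ea phi \in Lw)) /=.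
  congr (_ + _).
    rewrite (partition_big ea (mem Lw)) //= big_enum_val.
    apply: eq_bigr => a _; rewrite !mxE mulr_sumr.
    apply: eq_big => [phi|phi /andP[_ /eqP phia]]; last by rewrite /T phia; ring.
    by rewrite andb_idl // => /eqP ->; apply: enum_valP.
  rewrite (bigID (fun phi => eb phi \in Lw)) /= [X in _ + X]big1 => [|phi /andP[/negPf na /negPf nb]].
    rewrite addr0 (partition_big eb (mem Lw)) => [|phi /andP[]//].
    rewrite big_enum_val; apply: eq_bigr => b _; rewrite !mxE mulr_suml.
    apply: eq_big => [phi|phi /andP[_ /eqP phib]]; last by rewrite /T phib; ring.
    by rewrite -andbA; congr (_ && _); rewrite andb_idl // => /eqP ->; apply: enum_valP.
  have := exponents_low phi; rewrite na nb /= => /h_low c0.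
  by rewrite /T /c c0 mulr0.
rewrite -(mxrank1 'F_3 r) PQ; apply: leq_trans (mxrank_add _ _) _.
by apply: leq_add; apply: mulmx_max_rank.
Qed.
End Capset.

(** * Full lines in dense sets, and affine subspaces *)

Definition line_core (F : finFieldType) n (A : {set 'rV[F]_n}) (v : 'rV[F]_n) : {set 'rV[F]_n} :=
  [set x | [forall c : F, x + c *: v \in A]].

Lemma line_coreP (F : finFieldType) n (A : {set 'rV[F]_n}) v x :
  reflect (forall c : F, x + c *: v \in A) (x \in line_core A v).
Proof. by rewrite inE; apply: forallP. Qed.

Lemma line_core_sub (F : finFieldType) n (A : {set 'rV[F]_n}) v : {subset line_core A v <= A}.
Proof. by move=> x /line_coreP /(_ 0); rewrite scale0r addr0. Qed.

Lemma free_family_off (F : fieldType) (vT : vectType F) (D : nat) (X W0 : {vspace vT}) :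
  (D + \dim W0 <= \dim X)%N ->
  exists iota : 'rV[F]_D -> vT,
    [/\ forall u v c, iota (u + c *: v) = iota u + c *: iota v,
        forall u, iota u \in X & forall u, iota u \in W0 -> u = 0].
Proof.
move=> dimD; pose H := (X :\: W0)%VS.
have dimH : (D <= \dim H)%N.
  rewrite -(leq_add2r (\dim W0)) (leq_trans dimD) // -(dimv_cap_compl X W0).
  by rewrite addnC leq_add2l dimvS ?capvSr.
have szE : size (take D (vbasis H)) == D by rewrite size_takel // size_tuple.
pose E := Tuple szE.
have freeE : free E.
  have := basis_free (vbasisP H); rewrite -{1}(cat_take_drop D (vbasis H)).
  exact: catl_free.
have EH (i : 'I_D) : E`_i \in H.
  by apply: vbasis_mem; apply: (@mem_take D); apply: mem_nth; rewrite (eqP szE).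
pose iota (u : 'rV[F]_D) := \sum_(i < D) u 0 i *: E`_i.
have iotaH u : iota u \in H by apply: rpred_sum => i _; apply: rpredZ.
exists iota; split.
- move=> u v c; rewrite /iota scaler_sumr -big_split; apply: eq_bigr => i _ /=.
  by rewrite !mxE scalerDl scalerA.
- by move=> u; apply: (subvP (diffvSl X W0)).
move=> u uW0; apply/rowP => i; rewrite mxE.
move/freeP: freeE => /(_ (fun i => u 0 i)); apply.
by apply/eqP; rewrite -memv0 -(capv_diff X W0) memv_cap iotaH.
Qed.

(** Average over the translates a + iota(F^D), a in X. In each, the points of A through which no
    line with direction in the image of [iota] lies in A form a line-free set, so there are at most
    [cap] of them. By the density hypothesis they make up at most half of A, and fewer than q^D
    directions share the rest. *)
Lemma popular_direction (F : finFieldType) n D cap (X W0 : {vspace 'rV[F]_n})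
    (A : {set 'rV[F]_n}) :
  (forall B : {set 'rV[F]_D}, affine_line_free B -> (#|B| <= cap)%N) ->
  {subset A <= X} -> (0 < #|A|)%N -> (D + \dim W0 <= \dim X)%N ->
  (2 * cap * #|F| ^ \dim X <= #|A| * #|F| ^ D)%N ->
  exists2 v, (v \in X) && (v \notin W0) & (#|A| <= 2 * #|F| ^ D * #|line_core A v|)%N.
Proof.
move=> capP AX A0 dimD dens.
have [iota [iotaD iotaX iotaW0]] := free_family_off dimD.
have card_translate (C : {set 'rV[F]_n}) u : {subset C <= X} ->
    (\sum_(a in X) (a + iota u \in C)%R = #|C|)%N.
  move=> CX; rewrite -sum1_card [RHS](reindex_inj (addIr (iota u))) /=.
  rewrite [LHS]big_mkcond [RHS]big_mkcond; apply: eq_bigr => a _.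
  have [aC|_] := boolP (a + iota u \in C); last by case: ifP.
  suff -> : a \in X by [].
  by rewrite -(addrK (iota u) a) rpredB ?iotaX ?CX.
have perA a : (\sum_u (a + iota u \in A)%R <=
    cap + \sum_(v | v != 0%R) \sum_u (a + iota u \in line_core A (iota v))%R)%N.
  pose B := [set u | (a + iota u \in A) &&
                     [forall (v | v != 0), a + iota u \notin line_core A (iota v)]].
  have /capP capB : affine_line_free B.
    move=> u v v0 uvB; have := uvB 0; rewrite scale0r addr0 inE => /andP[_ /forall_inP/(_ v v0)].
    case/negP; apply/line_coreP => c; rewrite -addrA -iotaD.
    by have := uvB c; rewrite inE => /andP[].
  set S := (\sum_(v | v != 0%R) _)%N; apply: (@leq_trans (#|B| + S)%N); last by rewrite leq_add2r.
  rewrite {}/S exchange_big -sum1_card [X in (_ <= X + _)%N]big_mkcond -big_split /=.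
  apply: leq_sum => u _; rewrite inE; case: (_ \in A) => //=.
  case: ifP => [//|/negbT/forall_inPn[v v0]].
  by rewrite negbK => uv; rewrite (bigD1 v) //= uv.
have total : (#|F| ^ D * #|A| <=
    #|F| ^ \dim X * cap + #|F| ^ D * \sum_(v | v != 0%R) #|line_core A (iota v)|)%N.
  have cardD : #|{: 'rV[F]_D}| = (#|F| ^ D)%N by rewrite card_mx mul1n.
  rewrite -[in X in (X <= _)%N]cardD -sum_nat_const.
  rewrite (eq_bigr (fun u => \sum_(a in X) (a + iota u \in A)%R)%N); last first.
    by move=> u _; rewrite card_translate.
  rewrite exchange_big /=; apply: leq_trans (leq_sum _ (fun a _ => perA a)) _.
  rewrite big_split /= sum_nat_const card_vspace leq_add2l.
  rewrite exchange_big big_distrr /=; apply: leq_sum => v _.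
  rewrite exchange_big /= -cardD -sum_nat_const; apply: leq_sum => u _.
  by rewrite card_translate // => x /line_core_sub /AX.
have [/existsP[v /andP[v0 hv]]|/existsPn noV] :=
  boolP [exists v, (v != 0) && (#|A| <= 2 * #|F| ^ D * #|line_core A (iota v)|)%N].
  exists (iota v) => //; rewrite iotaX /=; apply: contra v0 => /iotaW0 ->.
  by rewrite eqxx.
have small : (\sum_(v : 'rV[F]_D | v != 0%R) 2 * #|F| ^ D * #|line_core A (iota v)|
              <= (#|F| ^ D - 1) * #|A|)%N.
  have <- : #|[pred v : 'rV[F]_D | v != 0]| = (#|F| ^ D - 1)%N.
    by rewrite subn1 -[in RHS](mul1n D) -card_mx -(cardC1 (0 : 'rV[F]_D)); apply: eq_card.
  rewrite -sum_nat_const; apply: leq_sum => v v0.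
  by have := noV v; rewrite v0 /= -ltnNge => /ltnW.
rewrite -big_distrr /= in small.
have qD : (0 < #|F| ^ D)%N by rewrite expn_gt0 (ltnW (finNzRing_gt1 F)).
exfalso; move: total small dens qD A0.
move: (\sum_(v | _) _)%N (#|F| ^ D)%N (#|F| ^ \dim X)%N #|A| => S Q P a.
by nia.
Qed.

(* The density |A| / #|F|^(dim X) of A in X is measured by the least s with density >= (p'/p)^s;
   one more direction of the affine subspace costs s + w |-> b * (s + w). *)
Definition supersaturated (F : finFieldType) (p p' b w : nat) :=
  forall n (X W0 : {vspace 'rV[F]_n}) (A : {set 'rV[F]_n}) s s',
    {subset A <= X} -> (s' + w = b * (s + w))%N ->
    (b * (s + w) + 2 * \dim W0 <= 2 * \dim X)%N ->
    (p' ^ s * #|F| ^ \dim X <= #|A| * p ^ s)%N ->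
    exists2 v, (v \in X) && (v \notin W0) &
      (p' ^ s' * #|F| ^ \dim X <= #|line_core A v| * p ^ s')%N.

Lemma line_free_card_F2 n (B : {set 'rV['F_2]_n}) : affine_line_free B -> (#|B| <= 1)%N.
Proof.
move=> lfB; apply/card_le1_eqP => x y xB yB; apply/esym/eqP/negPn/negP => neq.
apply: (lfB x (y - x)); first by rewrite subr_eq0 eq_sym.
case=> [[|[|//]] ?].
- by rewrite (_ : Ordinal _ = 0) ?scale0r ?addr0 //; apply/val_inj.
- by rewrite (_ : Ordinal _ = 1) ?scale1r ?subrKC //; apply/val_inj.
Qed.

(** Line-free sets have at most one point, so D = s + 1 suffices. The loss 2 * 2^(s+1) turns density
    2^(-s) into 2^(-(2s+2)), and 2s + 2 + 2 = 2(s + 2). *)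
Lemma supersaturated_F2 : supersaturated 'F_2 2 1 2 2.
Proof.
move=> n X W0 A s s' AX s'E dimX; rewrite !exp1n !mul1n card_Fp // => dens.
have A0 : (0 < #|A|)%N by rewrite lt0n; apply: contraTneq dens => ->; rewrite -ltnNge expn_gt0.
have [||v vX hv] := @popular_direction _ n s.+1 1 X W0 A (@line_free_card_F2 _) AX A0.
- by lia.
- by rewrite card_Fp // expnS muln1 mulnCA leq_mul.
exists v; rewrite // (leq_trans dens) // (leq_trans (leq_mul hv (leqnn _))) //.
have -> : s' = (s.+2 + s)%N by lia.
by rewrite card_Fp // -expnS mulnAC -expnD mulnC.
Qed.

Lemma leq_mul_expn_rat (a b c n : nat) :
  (a%:R * b%:R ^+ n <= c%:R ^+ n :> rat) -> (a * b ^ n <= c ^ n)%N.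
Proof. by rewrite -(ler_nat rat) natrM !natrX. Qed.

(** The base comes from 432 = 27 * 16: a line-free set in F_3^(3e) has density at most 3
    (343/432)^e. *)
Lemma pow343_ineqs : [/\ 6 * 343 ^ 8 <= 432 ^ 8, 27 * 343 ^ 15 <= 432 ^ 15,
   2 * 343 ^ 4 <= 432 ^ 4 & 3 * 343 ^ 5 <= 432 ^ 5]%N.
Proof. by split; apply: leq_mul_expn_rat; lra. Qed.

Lemma density_to_count (M V U Ks Ls K8 L8 P a : nat) :
  (0 < V)%N -> (0 < Ks)%N -> (U * V = Ls * L8)%N -> (6 * K8 <= L8)%N ->
  (M * V <= Ks * K8)%N -> (Ks * P <= a * Ls)%N -> (2 * (3 * M) * P <= a * U)%N.
Proof.
move=> V0 Ks0 UV c6 MV dens; rewrite -(@leq_pmul2r (V * Ks)) ?muln_gt0 ?V0 //.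
have -> : (2 * (3 * M) * P * (V * Ks) = 6 * (M * V * (Ks * P)))%N by lia.
have -> : (a * U * (V * Ks) = L8 * (Ks * (a * Ls)))%N by transitivity (U * V * (Ks * a))%N; [lia|rewrite UV; lia].
have := leq_mul c6 (leqnn (Ks * (a * Ls))); have := leq_mul MV dens; lia.
Qed.

Lemma count_to_density (U Ks Ls K1 K2 L1 L2 P a c : nat) :
  (U * K1 <= L1)%N -> (2 * K2 <= L2)%N -> (a <= 2 * U * c)%N -> (Ks * P <= a * Ls)%N ->
  (K1 * K2 * Ks * P <= c * (L1 * L2 * Ls))%N.
Proof.
move=> h1 h2 hv dens.
apply: leq_trans (_ : K1 * K2 * (2 * U * c * Ls) <= _)%N.
  by rewrite -mulnA leq_mul // (leq_trans dens) // leq_mul.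
have := leq_mul (leq_mul h1 h2) (leqnn (c * Ls)); lia.
Qed.

(** With D = 3(s + 8), the inequality 6 (343/432)^8 <= 1 makes line-free sets at most half as dense
    as A. The loss 2 * 27^(s+8) costs at most 15(s + 8) + 15 further powers of 343/432, and s + 15(s
    + 8) + 15 + 9 = 16(s + 9). *)
Lemma supersaturated_F3 : supersaturated 'F_3 432 343 16 9.
Proof.
have [] := pow343_ineqs; have : (27 * 16 = 432)%N by [].
have : (0 < 343)%N by [].
(* Abstracting the numerals prevents evaluation of their powers. *)
move: 343%N 432%N (@card_low_exponents) => K L cardlow K0 uv c6 c27 c2 _.
move=> n X W0 A s s' AX s'E dimX; rewrite card_Fp // => dens.
have A0 : (0 < #|A|)%N.
  by rewrite lt0n; apply: contraTneq dens => ->; rewrite -ltnNge muln_gt0 !expn_gt0 K0.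
have dimD : (3 * (s + 8) + \dim W0 <= \dim X)%N by lia.
have [|v vX hv] := popular_direction (@line_free_card_F3 (s + 8)) AX A0 dimD.
  rewrite card_Fp // expnM.
  have := cardlow (s + 8)%N; rewrite (expnD K) => lowE.
  apply: (density_to_count _ _ _ c6 lowE dens); rewrite ?expn_gt0 ?K0 //.
  by rewrite -expnMn -expnD uv.
exists v => //.
have c2' : (2 * K ^ 15 <= L ^ 15)%N by rewrite (leq_trans _ c27) // leq_mul.
have -> : s' = (15 * (s + 8) + 15 + s)%N by lia.
rewrite !(expnD _ _ s) !(expnD _ _ 15); rewrite card_Fp // expnM in hv.
apply: (count_to_density _ c2' hv dens).
by rewrite expnM [X in (_ <= X)%N]expnM -expnMn leq_exp2r ?addn_gt0 ?orbT.
Qed.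

(** Directions are chosen one at a time, passing from A to [line_core A v] and from W0 to W0 +
    <[v]>. Each step multiplies s + w by b; the term 2 * m pays for the growth of W0. *)
Lemma affine_subspace (F : finFieldType) (p p' b w : nat) :
  supersaturated F p p' b w -> (0 < b)%N -> (0 < p')%N ->
  forall m n (X W0 : {vspace 'rV[F]_n}) (A : {set 'rV[F]_n}) s,
    {subset A <= X} -> (2 * m + b ^ m * (s + w) + 2 * \dim W0 <= 2 * \dim X)%N ->
    (p' ^ s * #|F| ^ \dim X <= #|A| * p ^ s)%N ->
    exists x (W : {vspace 'rV[F]_n}),
      [/\ \dim W = m, (W :&: W0 = 0)%VS & forall y, y \in W -> x + y \in A].
Proof.
move=> satF b0 p'0 m n X; elim: m => [|m IHm] W0 A s AX dimX dens.
  have /card_gt0P[x xA] : (0 < #|A|)%N.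
    rewrite lt0n; apply: contraTneq dens => ->.
    by rewrite -ltnNge muln_gt0 !expn_gt0 p'0 (ltnW (finNzRing_gt1 F)).
  exists x, 0%VS; split; rewrite ?dimv0 ?cap0v //.
  by move=> y; rewrite memv0 => /eqP ->; rewrite addr0.
have sw : (w <= b * (s + w))%N by rewrite (leq_trans (leq_addl s w)) // leq_pmull.
have bm : (b * (s + w) <= b ^ m.+1 * (s + w))%N.
  by rewrite leq_mul // expnS leq_pmulr // expn_gt0 b0.
have [|v /andP[vX vW0] hv] := satF n X W0 A s (b * (s + w) - w)%N AX (subnK sw) _ dens.
  by lia.
have v0 : v != 0 by apply: contraNneq vW0 => ->; apply: mem0v.
have vW0_cap : (W0 :&: <[v]> = 0)%VS.
  apply/eqP; rewrite -subv0; apply/subvP => y; rewrite memv_cap memv0.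
  case/andP=> yW0 /vlineP[c yE]; 
  by move: yW0; rewrite yE rpredZeq scaler_eq0 (negPf vW0) orbF => ->.
have [||x [W [dimW WW0 xW]]] := IHm (W0 + <[v]>)%VS (line_core A v) _ _ _ hv.
- by move=> y /line_core_sub /AX.
- rewrite dimv_disjoint_sum // dim_vline v0 subnK //; rewrite expnS in dimX; lia.
have W_only0 y : y \in W -> y \in (W0 + <[v]>)%VS -> y = 0.
  by move=> yW yW0; apply/eqP; rewrite -memv0 -WW0 memv_cap yW.
exists x, (W + <[v]>)%VS; split.
- rewrite dimv_disjoint_sum ?dim_vline ?v0 ?dimW ?addn1 //.
  apply/eqP; rewrite -subv0; apply/subvP => y; rewrite memv_cap memv0 => /andP[yW yv].
  by apply/eqP/W_only0 => //; apply: (subvP (addvSr _ _)).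
- apply/eqP; rewrite -subv0; apply/subvP => y; rewrite memv_cap memv0.
  case/andP=> /memv_addP[y1 y1W [y2 y2v yE]] yW0.
  have y10 : y1 = 0.
    apply: W_only0 => //; apply/memv_addP; exists y => //; exists (- y2); first by rewrite memvN.
    by rewrite yE addrK.
  rewrite yE y10 add0r in yW0 *.
  by rewrite -memv0 -vW0_cap memv_cap yW0.
- move=> y /memv_addP[y1 y1W [y2 /vlineP[c ->] ->]].
  by rewrite addrA; have /line_coreP := xW _ y1W.
Qed.

(** * The Ramsey argument for colored points *)

Lemma vlineZ_unit (F : fieldType) (vT : vectType F) (c : F) (x : vT) :
  c != 0 -> <[c *: x]>%VS = <[x]>%VS.
Proof.
by move=> c0; apply/eqP; rewrite eqEdim -memvE memvZ ?memv_line // !dim_vline scaler_eq0 (negPf c0) /= leqnn.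
Qed.

Lemma dimv1_vline (F : fieldType) (vT : vectType F) (L : {vspace vT}) :
  \dim L = 1%N -> exists2 x, x != 0 & L = <[x]>%VS.
Proof.
move=> dimL; have L0 : vpick L != 0 by rewrite vpick0 -dimv_eq0 dimL.
exists (vpick L) => //; apply/esym/eqP.
by rewrite eqEdim -memvE memv_pick dimL dim_vline L0.
Qed.

(** Greedy extension: if dim U = j < T, the next vector must avoid U and A - U, at most q^j (|A| +
    1) <= q^j q^(dim X - T) < q^(dim X) vectors. *)
Lemma subspace_avoiding (F : finFieldType) n (X : {vspace 'rV[F]_n}) (A : {set 'rV[F]_n}) T :
  0 \notin A -> (forall c x, c *: x \in A -> x \in A) -> (T <= \dim X)%N ->
  (#|A| < #|F| ^ (\dim X - T))%N ->
  exists U : {vspace 'rV[F]_n}, [/\ (U <= X)%VS, \dim U = T & forall x, x \in U -> x \notin A].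
Proof.
move=> A0 Ascale TX cardA.
suff: forall j, (j <= T)%N -> exists U : {vspace 'rV[F]_n},
    [/\ (U <= X)%VS, \dim U = j & forall x, x \in U -> x \notin A].
  by apply.
elim=> [_|j IHj jT].
  by exists 0%VS; split; rewrite ?sub0v ?dimv0 // => x; rewrite memv0 => /eqP ->.
have [U [UX dimU UA]] := IHj (ltnW jT).
pose bad := [set x in U] :|: [set z.1 - z.2 | z in finset.setX A [set x in U]].
have card_bad : (#|bad| < #|X|)%N.
  have cardU : #|[set x in U]| = (#|F| ^ j)%N by rewrite cardsE card_vspace dimU.
  apply: leq_ltn_trans (leq_card_setU _ _) _.
  apply: leq_ltn_trans (leq_add (leqnn _) (leq_imset_card _ _)) _.
  rewrite cardsX cardU -mulSn card_vspace -(subnK TX) expnD.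
  apply: leq_ltn_trans (leq_mul cardA (leqnn _)) _.
  by rewrite ltn_pmul2l ?ltn_exp2l ?finNzRing_gt1 // expn_gt0 (ltnW (finNzRing_gt1 F)).
have /subsetPn[w wX] : ~~ (X \subset bad).
  by apply: contraTN card_bad => /subset_leq_card; rewrite -leqNgt.
rewrite !inE negb_or => /andP[wU wA].
exists (U + <[w]>)%VS; split.
- by rewrite subv_add UX -memvE.
- rewrite dimv_disjoint_sum ?dim_vline ?dimU.
    by rewrite (_ : w != 0) ?addn1 //; apply: contraNneq wU => ->; apply: mem0v.
  apply/eqP; rewrite -subv0; apply/subvP => y; rewrite memv_cap memv0.
  case/andP=> yU /vlineP[c yE]; 
  by move: yU; rewrite yE rpredZeq scaler_eq0 (negPf wU) orbF => ->.
move=> y /memv_addP[y1 y1U [y2 /vlineP[c ->] ->]].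
have [->|c0] := eqVneq c 0; first by rewrite scale0r addr0 UA.
(* Dividing y1 + c w in A by c exhibits w as an element of A - U. *)
apply: contra wA => yA; apply/imsetP; exists (c^-1 *: y1 + w, c^-1 *: y1); last first.
  by rewrite /= addrC addKr.
rewrite inE /= inE memvZ // andbT; apply: (Ascale c).
by rewrite scalerDr scalerA mulfV // scale1r.
Qed.

(** [u * T + v * H] is the exponent s guaranteed for some color, and b^m (s + w) is a dimension that
    yields an affine m-space, m being the bound for H - 1. *)
Fixpoint ramsey_bound (b w u v T H : nat) : nat :=
  match H with
  | 0%N => T
  | H'.+1 => (b ^ ramsey_bound b w u v T H' * (u * T + v * H + w))%N
  end.

Lemma ramsey_bound_ge b w u v T H : (1 < b)%N -> (0 < w)%N -> (T <= ramsey_bound b w u v T H)%N.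
Proof.
move=> b1 w0; elim: H => //= H IHH; rewrite (leq_trans IHH) //.
apply: leq_trans (ltnW (ltn_expl _ b1)) _.
by rewrite leq_pmulr // addn_gt0 w0 orbT.
Qed.

(** Let H be the total weight. If every c_i H were below Q, then c_i H <= wt_i (Q - 1), also where
    wt_i = 0; summing contradicts the lower bound on the sum when H > 0. *)
Lemma weighted_pigeonhole (I : eqType) (r : seq I) (c wt : I -> nat) Q :
  (0 < Q)%N -> (forall i, i \in r -> wt i = 0%N -> c i = 0%N) ->
  (Q <= \sum_(i <- r) c i)%N -> exists2 i, i \in r & (Q <= c i * \sum_(j <- r) wt j)%N.
Proof.
move=> Q0 cwt Qle; set H := (\sum_(j <- r) wt j)%N.
have [/hasP[i ir hi]|/hasPn small] := boolP (has (fun i => Q <= c i * H)%N r).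
  by exists i.
have : (\sum_(i <- r) c i * H <= \sum_(i <- r) wt i * (Q - 1))%N.
  rewrite [X in (X <= _)%N]big_seq [X in (_ <= X)%N]big_seq; apply: leq_sum => i ir.
  have := small i ir; have := cwt i ir; case: (wt i) => [->//|k _].
  by rewrite -ltnNge; nia.
rewrite -!big_distrl /= -/H; move: Qle; have [H0|] := posnP H; last by nia.
rewrite big_seq big1 => [|i ir]; first by lia.
by move/eqP: H0; rewrite sum_nat_seq_eq0 => /allP/(_ i ir)/= /eqP /(cwt i ir).
Qed.

Definition mono_subspace (F : fieldType) n (t : nat -> nat) k (X : {vspace 'rV[F]_n})
    (f : {vspace 'rV[F]_n} -> nat) :=
  exists2 i, (1 <= i <= k)%N & exists U : {vspace 'rV[F]_n},
    [/\ (U <= X)%VS, \dim U = t i &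
        forall L : {vspace 'rV[F]_n}, \dim L = 1%N -> (L <= U)%VS -> f L = i].

Definition color_class (F : finFieldType) n (X : {vspace 'rV[F]_n})
    (f : {vspace 'rV[F]_n} -> nat) (i : nat) : {set 'rV[F]_n} :=
  [set x in X | (x != 0) && (f <[x]>%VS == i)].

(** If few points avoid color k, some subspace of dimension t k misses them all. Otherwise a color i
    < k that occurs with t i = 1 wins on a single line; if there is none, the pigeonhole weights t i
    - 1 vanish only on empty classes. *)
Lemma dense_color (F : finFieldType) n (t : nat -> nat) k (X : {vspace 'rV[F]_n})
    (f : {vspace 'rV[F]_n} -> nat) :
  (0 < k)%N -> (forall i, 1 <= i < k -> 1 <= t i)%N -> (t k <= \dim X)%N ->
  (forall L : {vspace 'rV[F]_n}, \dim L = 1%N -> (L <= X)%VS -> (1 <= f L <= k)%N) ->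
  mono_subspace t k X f \/
  exists i, [/\ 1 <= i < k, 2 <= t i &
    #|F| ^ (\dim X - t k) <= #|color_class X f i| * \sum_(1 <= j < k) (t j - 1)]%N.
Proof.
move=> k0 tpos TX frange.
have colrange x : x \in X -> x != 0 -> (1 <= f <[x]>%VS <= k)%N.
  by move=> xX x0; apply: frange; rewrite ?dim_vline ?x0 // -memvE.
pose A := [set x in X | (x != 0) && (f <[x]>%VS != k)].
have [cardA|cardA] := ltnP #|A| (#|F| ^ (\dim X - t k)).
  left; exists k; first by rewrite k0 leqnn.
  have [||U [UX dimU UA]] := @subspace_avoiding F n X A (t k) _ _ TX cardA.
  - by rewrite inE eqxx andbF.
  - move=> c x; rewrite !inE; have [->|c0] := eqVneq c 0; first by rewrite scale0r eqxx andbF.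
    by rewrite vlineZ_unit // rpredZeq scaler_eq0 (negPf c0).
  exists U; split => // L /dimv1_vline[x x0 ->]; rewrite -memvE => xU.
  have := UA x xU; rewrite inE (subvP UX x xU) x0 /= negbK.
  by move/eqP.
have [ex|noex] := boolP [exists x in X, [&& x != 0, (f <[x]>%VS < k)%N & t (f <[x]>%VS) == 1%N]].
  left; have /exists_inP[x xX /and3P[x0 fk /eqP tf]] := ex.
  exists (f <[x]>%VS); first exact: colrange.
  exists <[x]>%VS; split; rewrite -?memvE ?tf ?dim_vline ?x0 // => L dimL Lx.
  by congr f; apply/eqP; rewrite eqEdim Lx dimL dim_vline x0.
have small i : (1 <= i < k)%N -> (t i <= 1)%N -> #|color_class X f i| = 0%N.
  move=> ik ti; apply/eqP; rewrite cards_eq0; apply/eqP/setP => x; rewrite !inE.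
  apply/negP => /and3P[xX x0 /eqP fx]; move/exists_inPn: noex => /(_ x xX).
  by rewrite x0 fx eqn_leq ti tpos // andbT /=; case/andP: ik => _ ->.
right.
have [|||i ik hi] := @weighted_pigeonhole _ (index_iota 1 k) (fun i => #|color_class X f i|)
   (fun i => t i - 1)%N (#|F| ^ (\dim X - t k)).
- by rewrite expn_gt0 (ltnW (finNzRing_gt1 F)).
- by move=> i; rewrite mem_index_iota => ik ti; apply: small => //; rewrite -subn_eq0 ti.
- apply: leq_trans cardA _; rewrite -sum1_card.
  apply: (@leq_trans (\sum_(1 <= i < k) \sum_(x in A) (f <[x]>%VS == i))%N); last first.
    apply: leq_sum => i _; rewrite -sum1_card big_mkcond [X in (_ <= X)%N]big_mkcond.
    apply: leq_sum => x _; rewrite !inE; case: (x \in X) => //=.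
    by case: (x != 0) => //=; case: (_ != k) => //=; case: (_ == i).
  rewrite exchange_big; apply: leq_sum => x; rewrite inE => /and3P[xX x0 fk].
  have /andP[f1 fk'] := colrange x xX x0.
  rewrite (bigD1_seq (f <[x]>%VS)) ?iota_uniq ?eqxx //=.
  by rewrite mem_index_iota f1 ltn_neqAle fk fk'.
exists i; move: ik; rewrite mem_index_iota => ik; split => //.
rewrite leqNgt ltnS; apply: contraL hi => /(small i ik) ->.
by rewrite mul0n -ltnNge expn_gt0 (ltnW (finNzRing_gt1 F)).
Qed.

Section Ramsey.
Variables (F : finFieldType) (p p' b w u v : nat).
Hypotheses (satF : supersaturated F p p' b w) (b1 : (1 < b)%N) (w1 : (1 < w)%N) (p'0 : (0 < p')%N).
Hypothesis densF :
  forall T H, (0 < H)%N -> (p' ^ (u * T + v * H) * (H * #|F| ^ T) <= p ^ (u * T + v * H))%N.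

Lemma ramsey_subspace n H (t : nat -> nat) k (X : {vspace 'rV[F]_n}) (f : {vspace 'rV[F]_n} -> nat) :
  (0 < k)%N -> (forall i, 1 <= i < k -> 1 <= t i)%N -> (\sum_(1 <= i < k) (t i - 1) = H)%N ->
  (ramsey_bound b w u v (t k) H <= \dim X)%N ->
  (forall L : {vspace 'rV[F]_n}, \dim L = 1%N -> (L <= X)%VS -> (1 <= f L <= k)%N) ->
  mono_subspace t k X f.
Proof.
move=> k0; elim: H t X => [|H IHH] t X tpos sumt dimX frange.
  (* For H = 0 the second alternative would bound a power of |F| by 0. *)
  have [//|[i [_ _]]] := dense_color k0 tpos dimX frange.
  by rewrite sumt muln0 leqn0 expn_eq0 -leqn0 leqNgt (ltnW (finNzRing_gt1 F)).
have TX : (t k <= \dim X)%N by apply: leq_trans dimX; apply: ramsey_bound_ge; rewrite // ltnW.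
have [//|[i [ik ti]]] := dense_color k0 tpos TX frange; rewrite sumt => dens.
set C := color_class X f i in dens.
have CX : {subset C <= X} by move=> x; rewrite inE => /andP[].
set s := (u * t k + v * H.+1)%N; set m := ramsey_bound b w u v (t k) H.
have [||x [W [dimW _ xW]]] := @affine_subspace F p p' b w satF (ltnW b1) p'0 m n X 0%VS C s CX.
(* As w >= 2, 2m <= b^m (s + w), so the factor 2 on dim X absorbs the term 2m. *)
- rewrite dimv0 /=; have := ltn_expl m b1; move: dimX => /=; rewrite -/m -/s; nia.
- rewrite -(subnK TX) expnD mulnA.
  apply: leq_trans (_ : p' ^ s * (#|C| * H.+1) * #|F| ^ t k <= _)%N.
    by rewrite !leq_mul.
  by have := leq_mul (leqnn #|C|) (@densF (t k) H.+1 isT); rewrite -/s; lia.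
have WX : (W <= X)%VS.
  apply/subvP => y yW; rewrite -(addKr x y) rpredD ?rpredN ?CX ?xW //.
  by have := xW 0; rewrite addr0; apply; apply: mem0v.
(* Otherwise x - x = 0 would lie in the color class. *)
have xNW : x \notin W.
  by apply/negP; rewrite -memvN => /xW; rewrite subrr !inE eqxx andbF.
pose t' j := if j == i then (t i - 1)%N else t j.
have i_neq_k : (k == i) = false by case/andP: ik => _ /gtn_eqF.
have [||||j jk [U [UW dimU Umono]]] := IHH t' W.
- by move=> j jk; rewrite /t'; case: eqP => _; [by rewrite subn_gt0|apply: tpos].
- have rest : (\sum_(1 <= j < k | j != i) (t' j - 1) = \sum_(1 <= j < k | j != i) (t j - 1))%N.
    by apply: eq_bigr => j /negPf ji; rewrite /t' ji.
  move: sumt; rewrite (bigD1_seq i) ?iota_uniq ?mem_index_iota //= -rest.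
  by rewrite [in X in _ -> X](bigD1_seq i) ?iota_uniq ?mem_index_iota //= {2}/t' eqxx; lia.
- by rewrite {1}/t' i_neq_k dimW.
- by move=> L dimL LW; apply: frange => //; apply: subv_trans WX.
rewrite /t' in dimU; have [ji|ji] := eqVneq j i; last first.
  rewrite (negPf ji) in dimU; exists j => //; exists U; split => //.
  exact: subv_trans WX.
rewrite ji eqxx in dimU Umono; exists i; first by case/andP: ik => -> /ltnW ->.
have xX : x \in X by rewrite CX // -[x]addr0 xW // mem0v.
exists (U + <[x]>)%VS; split.
- by rewrite subv_add (subv_trans UW WX) -memvE.
- rewrite dimv_disjoint_sum ?dim_vline ?dimU.
    rewrite (_ : x != 0) ?addn1 /=; first by lia.
    by apply: contraNneq xNW => ->; apply: mem0v.
  apply/eqP; rewrite -subv0; apply/subvP => y; rewrite memv_cap memv0.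
  case/andP=> /(subvP UW) yW /vlineP[c yE].
  by move: yW; rewrite yE rpredZeq scaler_eq0 (negPf xNW) orbF => ->.
move=> L /dimv1_vline[y y0 ->]; rewrite -memvE.
case/memv_addP=> y1 y1U [y2 /vlineP[c ->] yE].
have [c0|c0] := eqVneq c 0.
  apply: Umono; first by rewrite dim_vline y0.
  by rewrite -memvE yE c0 scale0r addr0.
(* For c != 0 the line of y = y1 + c x is that of x + c^-1 y1, a point of x + W. *)
have := xW (c^-1 *: y1) (memvZ _ (subvP UW _ y1U)).
rewrite inE => /and3P[_ _ /eqP <-]; congr f.
rewrite -[RHS](@vlineZ_unit _ _ c) // yE; congr (<[_]>%VS).
by rewrite scalerDr scalerA mulfV // scale1r addrC.
Qed.
End Ramsey.

(** * Estimates for C_0 and comparison with the tower *)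

Lemma iter_tower_ge (R : realType) (c : nat) (s : R) m x :
  (0 < c)%N -> c%:R <= s -> (iter m (expn c) x)%:R <= iter_tower s m x%:R.
Proof.
move=> c0 cs; have s1 : 1 <= s by apply: le_trans cs; rewrite ler1n.
elim: m => //= m IHm; rewrite natrX -powR_mulrn ?ler0n //.
apply: (@le_trans _ _ (s `^ (iter m (expn c) x)%:R)); last exact: ler_powR.
by apply: ge0_ler_powR; rewrite ?nnegrE ?ler0n // (le_trans _ s1).
Qed.

Lemma gamma_FP_term (R : realType) (y : R) : 0 < y ->
  (1 + y ^+ 3 + (y ^+ 3) ^+ 2) / (y ^+ 3) `^ (2 / 3) = (1 + y ^+ 3 + y ^+ 6) / y ^+ 2.
Proof.
move=> y0; rewrite -exprM; congr (_ / _).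
rewrite -(powR_mulrn 3 (ltW y0)) -powRrM.
by rewrite mulrCA mulfV ?pnatr_eq0 // mulr1 powR_mulrn ?ltW.
Qed.

(** With x = y^3 the claim is 1 + y^3 + y^6 >= (5/2) y^2, and the difference is (y^3 - 1/2)^2 + (y -
    5/6)^2 (2y + 5/6) + 37/216. *)
Lemma gamma_FP_lbound (R : realType) (x : R) : 0 < x ->
  5 / 2 <= (1 + x + x ^+ 2) / x `^ (2 / 3).
Proof.
move=> x0; have [y y0 ->] : exists2 y : R, 0 < y & x = y ^+ 3.
  exists (x `^ 3^-1); first exact: powR_gt0.
  by rewrite -powR_mulrn ?powR_ge0 // -powRrM mulVf ?pnatr_eq0 // powRr1 // ltW.
rewrite gamma_FP_term // ler_pdivlMr ?exprn_gt0 //.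
have := mulr_ge0 (sqr_ge0 (y - 5 / 6)) (_ : 0 <= 2 * y + 5 / 6).
have := sqr_ge0 (y ^+ 3 - 1 / 2).
nra.
Qed.

Lemma gamma_FP_bounds (R : realType) : 5 / 2 <= gamma_FP R < 3.
Proof.
have lb : lbound [set (1 + x + x ^+ 2) / x `^ (2 / 3) | x in `]0, (1 : R)[%classic]%classic (5 / 2).
  by move=> _ [x /= + <-]; rewrite in_itv /= => /andP[x0 _]; apply: gamma_FP_lbound.
have y0 : 0 < 3 / 4 :> R by lra.
(* The point x = (3/4)^3 witnesses gamma < 3, which keeps 1 - log_3 gamma positive. *)
have mem : [set (1 + x + x ^+ 2) / x `^ (2 / 3) | x in `]0, (1 : R)[%classic]%classic
    ((1 + (3 / 4) ^+ 3 + (3 / 4) ^+ 6) / (3 / 4) ^+ 2).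
  by exists ((3 / 4) ^+ 3); rewrite ?gamma_FP_term //= in_itv /=; apply/andP; split; lra.
apply/andP; split; first by apply: lb_le_inf => //; eexists; exact: mem.
apply: le_lt_trans (ge_inf _ mem) _; first by exists (5 / 2).
by rewrite ltr_pdivrMr ?exprn_gt0 //; lra.
Qed.

(** As 3^5 = 243 <= (5/2)^6, log_3 gamma >= 5/6, so C_0 >= 1 + 6. *)
Lemma C0_ge7 (R : realType) : 7 <= C0 R.
Proof.
have /andP[g_ge g_lt] := gamma_FP_bounds R.
have ln3 : 0 < ln 3 :> R by apply: ln_gt0; lra.
have g0 : 0 < gamma_FP R by lra.
have lt1 : ln (gamma_FP R) / ln 3 < 1 by rewrite ltr_pdivrMr // mul1r ltr_ln ?posrE //; lra.
have ge56 : 5 / 6 <= ln (gamma_FP R) / ln 3.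
  rewrite ler_pdivlMr //.
  suff : ln (3 ^+ 5) <= ln (gamma_FP R ^+ 6) by rewrite !lnXn //; lra.
  rewrite ler_ln ?posrE ?exprn_gt0 //.
  apply: (@le_trans _ _ ((5 / 2) ^+ 6)); first by lra.
  by apply: lerXn2r; rewrite ?nnegrE; lra.
rewrite /C0 -lerBlDl ler_pdivlMr; lra.
Qed.

(** The slack 2T + H supplies a factor 2^(2T + H) that absorbs the linear factor of the
    recursion. *)
Lemma ramsey_bound_F2_le T H : (2 <= T)%N ->
  (ramsey_bound 2 2 1 1 T H + 2 * T + H <= iter H (expn 2) (3 * T))%N.
Proof.
move=> T2; elim: H => [|H IHH]; first by rewrite /=; lia.
rewrite iterS; apply: leq_trans (_ : 2 ^ (ramsey_bound 2 2 1 1 T H + 2 * T + H) <= _)%N; last first.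
  by rewrite leq_exp2l.
have NT := @ramsey_bound_ge 2 2 1 1 T H isT isT.
have P4 : (2 ^ 2 <= 2 ^ ramsey_bound 2 2 1 1 T H)%N by rewrite leq_exp2l // (leq_trans T2).
rewrite /= -[X in (_ <= 2 ^ X)%N]addnA expnD; move: (2 ^ ramsey_bound _ _ _ _ _ _)%N P4 => P P4.
have Y : (2 * T + 2 * H + 3 <= 2 ^ (2 * T + H))%N.
  have [x xE] : exists x, (2 * T + H = x.+1)%N by exists (2 * T + H).-1; lia.
  by rewrite xE expnS; have := @ltn_expl 2 x isT; move: (2 ^ x)%N => y; lia.
have := leq_mul P4 (leqnn (T + H)); have := leq_mul (leqnn P) Y.
move: (2 ^ (2 * T + H))%N => Z; lia.
Qed.

(** The weights 3 and 2 reflect 16^2 <= 7^3; the slack supplies a factor 7^(T + H) that absorbs the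
    linear factor of the recursion. *)
Lemma ramsey_bound_F3_le T H : (2 <= T)%N ->
  (3 * ramsey_bound 16 9 5 4 T H + 2 * T + 2 * H <= 2 * iter H (expn 7) (3 * T))%N.
Proof.
move=> T2; elim: H => [|H IHH]; first by rewrite /=; lia.
have NT := @ramsey_bound_ge 16 9 5 4 T H isT isT.
rewrite iterS /=; set N := ramsey_bound 16 9 5 4 T H in IHH NT *.
set tow := iter H _ _ in IHH *.
have P16 : (16 <= 16 ^ N)%N by rewrite -[X in (X <= _)%N]expn1 leq_exp2l //; lia.
have step : (16 ^ N * 7 ^ (T + H) <= 7 ^ tow)%N.
  rewrite -(@leq_exp2r _ _ 2) // expnMn -!expnM [(tow * 2)%N]mulnC.
  apply: leq_trans (_ : 7 ^ (3 * N + 2 * T + 2 * H) <= _)%N; last by rewrite leq_exp2l.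
  have -> : (3 * N + 2 * T + 2 * H = 3 * N + (T + H) * 2)%N by lia.
  rewrite expnD leq_mul // [(N * 2)%N]mulnC !expnM.
  by rewrite leq_exp2r //; lia.
(* Three times the linear factor is 15T + 12H + 39; raising 15 to 16 leaves room for the new
   slack. *)
have Y x : (2 <= x)%N -> (16 * x + 39 <= 2 * 7 ^ x)%N.
  elim: x => // -[|[|x]] // IHx _; have := IHx isT; rewrite (expnS 7 x.+2).
  by move: (7 ^ x.+2)%N => z; lia.
have Y' : (16 * (T + H) + 39 <= 2 * 7 ^ (T + H))%N by apply: Y; lia.
move: (16 ^ N)%N P16 step => P P16; move: (7 ^ (T + H))%N Y' => Z Y' step.
have := leq_mul P16 (leqnn (T + H)); have := leq_mul (leqnn P) Y'; lia.
Qed.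

(** The factor h <= 2^h costs 4h powers of 432/343, and 3^T costs 5T. *)
Lemma density_F3 T h :
  (343 ^ (5 * T + 4 * h) * (h * 3 ^ T) <= 432 ^ (5 * T + 4 * h))%N.
Proof.
have [_ _] := pow343_ineqs; move: 343%N 432%N => K L c2 c3.
rewrite (leq_trans (_ : _ <= K ^ (5 * T + 4 * h) * (2 ^ h * 3 ^ T))%N) //.
  by rewrite !leq_mul // ltnW // ltn_expl.
rewrite !(expnD _ (5 * T)).
have le_exp a b c e : (a <= b -> c = e -> a ^ c <= b ^ e)%N by move=> ab <-; case: c => // c; rewrite leq_exp2r.
have hT : (3 ^ T * K ^ (5 * T) <= L ^ (5 * T))%N by rewrite !(expnM _ 5) -expnMn le_exp.
have hh : (2 ^ h * K ^ (4 * h) <= L ^ (4 * h))%N by rewrite !(expnM _ 4) -expnMn le_exp.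
by have := leq_mul hT hh; lia.
Qed.

(* R_q(t_1..t_k) <= tau_h(3 t_k) stated as: some n <= tau_h(3 t_k) has the Ramsey property. *)
Theorem theorem1p3 (R : realType) (q k : nat) (t : nat -> nat) :
  (q = 2%N \/ q = 3%N) -> (2 <= k)%N ->
  (2 <= t 1%N)%N ->
  (forall i : nat, (1 <= i)%N -> (i < k)%N -> (t i <= t i.+1)%N) ->
  exists n : nat,
    (n%:R <= tau (sigma_q R q) (\sum_(1 <= i < k) (t i - 1) + 1)%N (3 * t k)%N%:R :> R)
    /\ ramsey_prop q k t n.
Proof.
move=> q23 k2 t1 tmono; set H := (\sum_(1 <= i < k) (t i - 1))%N.
have t2 i : (1 <= i <= k)%N -> (2 <= t i)%N.
  elim: i => // -[//|i] IHi /andP[_ ik].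
  by apply: leq_trans (tmono i.+1 isT ik); apply: IHi; apply: ltnW.
have k0 : (0 < k)%N by apply: ltnW.
have tk : (2 <= t k)%N by apply: t2; rewrite k0 leqnn.
have tpos i : (1 <= i < k)%N -> (1 <= t i)%N.
  by move=> /andP[i0 ik]; rewrite ltnW // t2 // i0 ltnW.
have to_ramsey (F : finFieldType) n (f : {vspace 'rV[F]_n} -> nat) :
    mono_subspace t k fullv f ->
    exists i : nat, (1 <= i <= k)%N /\ exists U : {vspace 'rV[F]_n}, \dim U = t i /\
      forall L : {vspace 'rV[F]_n}, \dim L = 1%N -> (L <= U)%VS -> f L = i.
  by case=> i ik [U [_ dimU fU]]; exists i; split=> //; exists U.
rewrite /tau addn1 /=; case: q23 => ->.
  exists (ramsey_bound 2 2 1 1 (t k) H); split.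
    apply: le_trans (iter_tower_ge H (3 * t k) (isT : (0 < 2)%N) (lexx 2)).
    by rewrite ler_nat; have := ramsey_bound_F2_le H tk; lia.
  move=> f frange; apply: to_ramsey.
  apply: (ramsey_subspace (u := 1) (v := 1) supersaturated_F2) => //.
  - move=> T h _; rewrite card_Fp // exp1n !mul1n addnC expnD; by apply: leq_mul; first exact/ltnW/ltn_expl.
  - by rewrite dimvf /dim /= mul1n.
  - by move=> L dimL _; apply: frange.
exists (ramsey_bound 16 9 5 4 (t k) H); split.
  apply: le_trans (iter_tower_ge H (3 * t k) (isT : (0 < 7)%N) (C0_ge7 R)).
  by rewrite ler_nat; have := ramsey_bound_F3_le H tk; lia.
move=> f frange; apply: to_ramsey.
apply: (ramsey_subspace (u := 5) (v := 4) supersaturated_F3) => //.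
- move=> T h _; rewrite card_Fp //; exact: density_F3.
- by rewrite dimvf /dim /= mul1n.
- by move=> L dimL _; apply: frange.
Qed.
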